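(* Let $c\ge 0$ be a fixed real number. As $n\to\infty$ through the even positive integers, $$\lim_{n\to\infty}\frac{b_n([\frac12n+\frac12c\sqrt{n}])}{b_n(\frac12n)}=\lim_{n\to\infty}\binom{n}{[\frac12n+\frac12c\sqrt{n}]}\Big/\binom{n}{\frac12n}=\exp\left(-\tfrac12c^2\right),$$ where $b_n(j)=\binom{n}{j}\left(\frac12\right)^n$.
   Context: For real $x$, $[x]=\max\{z\in\mathbb{Z}:z\le x\}$ denotes the integer part of $x$. The numbers $b_n(j)$, $j=0,1,\ldots,n$, are the binomial $(n,\frac12)$ probabilities; the binomial coefficient $\binom{n}{j}$ is $0$ for $j>n$. *)

(* Defs.v *)
From HB Require Import structures.
From mathcomp Require Import all_boot all_order all_algebra.
From mathcomp Require Import all_classical all_reals all_analysis.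

Set Implicit Arguments.
Unset Strict Implicit.
Unset Printing Implicit Defensive.

Import Order.TTheory GRing.Theory Num.Theory.
Import numFieldNormedType.Exports.

Local Open Scope classical_set_scope.
Local Open Scope ring_scope.

Definition binom_half (R : realType) (n j : nat) : R :=
  'C(n, j)%:R * (2^-1) ^+ n.

(* [Num.floor] is the integer part [x] = max {z in Z : z <= x}. The absolute
   value only casts int to nat: for c >= 0 the integer part is nonnegative. *)
Definition shifted_index (R : realType) (c : R) (n : nat) : nat :=
  `|Num.floor (2^-1 * n%:R + 2^-1 * c * Num.sqrt n%:R : R)|%N.

(* The filter "n tends to infinity through the even positive integers". *)
Definition even_infty : set_system nat :=
  within [set n : nat | (0 < n)%N /\ ~~ odd n] \oo.

(* Main.v *)
(** Write n = 2m and j = [c/2 sqrt(2m)], so that the index is m + j.  The quotient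
    of binomial coefficients is the product of (m-i)/(m+j-i) over i < j, and since
    1 + x <= exp x each factor lies between exp(-j/(m-j)) and exp(-j/(m+j)).
    Hence the quotient lies between exp(-j^2/(m-j)) and exp(-j^2/(m+j)), where
    j^2/m -> c^2/2 and j/m -> 0. *)
Require Import Defs.
From HB Require Import structures.
From mathcomp Require Import all_boot all_order all_algebra.
From mathcomp Require Import all_classical all_reals all_analysis.
From mathcomp Require Import ring lra.

Set Implicit Arguments.
Unset Strict Implicit.
Unset Printing Implicit Defensive.

Import Order.TTheory GRing.Theory Num.Theory.
Import numFieldNormedType.Exports.

Local Open Scope classical_set_scope.
Local Open Scope ring_scope.

(** Multiplied by [m! * (m - j)!], both sides become [(2m)!]. The form without division keeps the
    computation in [nat]. *)
Lemma bin_central_ffact (m j : nat) : (j <= m)%N ->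
  ('C(m.*2, m + j) * (m + j) ^_ j = 'C(m.*2, m) * m ^_ j)%N.
Proof.
move=> jm.
have le1 : (m + j <= m.*2)%N by rewrite -addnn leq_add2l.
have le2 : (m <= m.*2)%N by rewrite -addnn leq_addr.
have f1 := bin_fact le1; have f2 := bin_fact le2.
have e1 : (m.*2 - (m + j) = m - j)%N by rewrite -addnn subnDl.
have e2 : (m.*2 - m = m)%N by rewrite -addnn addnK.
have f3 := ffact_fact (leq_addl m j); rewrite addnK in f3.
have f4 := ffact_fact jm.
rewrite e1 -f3 in f1; rewrite e2 -{2}f4 in f2.
apply/eqP; rewrite -(@eqn_pmul2r (m`! * (m - j)`!)) ?muln_gt0 ?fact_gt0//.
apply/eqP; transitivity (m.*2)`!; [rewrite -f1 | rewrite -f2]; ring.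
Qed.

Lemma bin_central_ratio (R : numFieldType) (m j : nat) : (j <= m)%N ->
  'C(m.*2, m + j)%:R / 'C(m.*2, m)%:R
    = \prod_(i < j) ((m%:R - i%:R) / (m%:R + j%:R - i%:R)) :> R.
Proof.
move=> jm.
have -> : \prod_(i < j) ((m%:R - i%:R) / (m%:R + j%:R - i%:R))
    = (m ^_ j)%:R / ((m + j) ^_ j)%:R :> R.
  rewrite prodf_div !ffact_prod !natr_prod.
  congr (_ / _); apply: eq_bigr => i _.
    by rewrite natrB// (leq_trans (ltnW (ltn_ord i))).
  by rewrite natrB ?natrD// (leq_trans (ltnW (ltn_ord i)))// leq_addl.
have C0 : 'C(m.*2, m)%:R != 0 :> R.
  by rewrite pnatr_eq0 -lt0n bin_gt0 -addnn leq_addr.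
have F0 : ((m + j) ^_ j)%:R != 0 :> R.
  by rewrite pnatr_eq0 -lt0n ffact_gt0 leq_addl.
apply/eqP; rewrite eqr_div// -!natrM; apply/eqP; congr _%:R.
by rewrite bin_central_ffact// mulnC.
Qed.

Lemma bin_central_ratio_bounds (R : realType) (m j : nat) : (j < m)%N ->
  expR (- (j%:R ^+ 2 / (m%:R - j%:R) : R))
    <= 'C(m.*2, m + j)%:R / 'C(m.*2, m)%:R
    <= expR (- (j%:R ^+ 2 / (m%:R + j%:R) : R)).
Proof.
move=> jm; rewrite (bin_central_ratio R (ltnW jm)).
(* Splitting the exponent into [j] equal shares reduces both bounds to a comparison factor by
   factor. *)
have powE (x : R) : expR (- (j%:R ^+ 2 / x)) = \prod_(i < j) expR (- (j%:R / x)).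
  by rewrite prodr_const card_ord -expRM_natl; congr expR; ring.
have mj : j%:R < m%:R :> R by rewrite ltr_nat.
have j0 : 0 <= j%:R :> R by [].
rewrite !powE; apply/andP; split; apply: ler_prod => i _.
- rewrite expR_ge0/=.
  have ij : i%:R <= j%:R :> R by rewrite ler_nat ltnW.
  (* As an inverse, the factor is bounded below by bounding [1 + j/(m-i)] above by [1 + j/(m-j)],
     hence by [exp(j/(m-j))]. *)
  have -> : (m%:R - i%:R) / (m%:R + j%:R - i%:R)
      = (1 + j%:R / (m%:R - i%:R))^-1 :> R by field; rewrite !gt_eqF//; lra.
  rewrite expRN lef_pV2 ?posrE ?expR_gt0//; last first.
    by rewrite ltr_wpDr// divr_ge0//; lra.
  apply: le_trans (expR_ge1Dx _).
  by rewrite lerD2l ler_wpM2l// lef_pV2 ?posrE; lra.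
- have i0 : 0 <= i%:R :> R by [].
  have ij : i%:R <= j%:R :> R by rewrite ler_nat ltnW.
  apply/andP; split; first by rewrite divr_ge0//; lra.
  apply: le_trans (expR_ge1Dx _).
  (* Here [1 + x <= exp x] serves with the negative [x = -j/(m+j)], since [j/(m+j-i) >= j/(m+j)]. *)
  have -> : (m%:R - i%:R) / (m%:R + j%:R - i%:R)
      = 1 - j%:R / (m%:R + j%:R - i%:R) :> R by field; rewrite gt_eqF//; lra.
  by rewrite lerD2l lerN2 ler_wpM2l// lef_pV2 ?posrE; lra.
Qed.

Lemma cvgr_sqrtn (R : realType) : Num.sqrt n%:R @[n --> \oo] --> (+oo : set_system R).
Proof.
apply/cvgryPge => A; near=> n.
apply: (le_trans (ler_norm A)); rewrite -sqrtr_sqr ler_wsqrtr//.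
near: n; exact: nbhs_infty_ger.
Unshelve. all: end_near. Qed.

Lemma cvg_invr_sqrtn (R : realType) :
  (Num.sqrt n%:R)^-1 @[n --> \oo] --> (0 : R).
Proof.
apply/gtr0_cvgV0; last exact: cvgr_sqrtn.
by near=> n; rewrite sqrtr_gt0 ltr0n; near: n; exact: nbhs_infty_gt.
Unshelve. all: end_near. Qed.

(** Taking the floor loses less than 1, so the quotient is within [1 / sqrt n] of [a]; [0 <= a]
    makes the absolute value harmless. *)
Lemma cvg_floor_sqrtn (R : realType) (a : R) : 0 <= a ->
  `|Num.floor (a * Num.sqrt n%:R)|%N%:R / Num.sqrt n%:R @[n --> \oo] --> a.
Proof.
move=> a0.
apply: (@squeeze_cvgr _ \oo _ R (fun n => a - (Num.sqrt n%:R)^-1) (fun=> a)).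
- near=> n.
  have s0 : 0 < Num.sqrt n%:R :> R.
    by rewrite sqrtr_gt0 ltr0n; near: n; exact: nbhs_infty_gt.
  have f0 : 0 <= Num.floor (a * Num.sqrt n%:R) by rewrite floor_ge0 mulr_ge0// ltW.
  rewrite natr_absz ger0_norm//.
  have /andP[fl fu] := floor_itv (a * Num.sqrt n%:R).
  rewrite intrD in fu.
  rewrite ler_pdivlMr// ler_pdivrMr// fl andbT mulrBl mulVf ?gt_eqF//.
  by rewrite lerBlDr ltW.
- rewrite -[X in _ --> X]subr0; apply: cvgB; [exact: cvg_cst|exact: cvg_invr_sqrtn].
- exact: cvg_cst.
Unshelve. all: end_near. Qed.

Lemma cvg_bin_central_ratio (R : realType) (a : R) (j : nat -> nat) :
  (j n)%:R / Num.sqrt n%:R @[n --> \oo] --> a ->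
  'C(n.*2, n + j n)%:R / 'C(n.*2, n)%:R @[n --> \oo] --> expR (- a ^+ 2).
Proof.
move=> ja.
have j0 : (j n)%:R / n%:R @[n --> \oo] --> (0 : R).
  have : ((j n)%:R / Num.sqrt n%:R) / Num.sqrt n%:R @[n --> \oo] --> (a * 0 : R).
    by apply: cvgM => //; exact: cvg_invr_sqrtn.
  rewrite mulr0; apply: cvg_trans; apply: near_eq_cvg; near=> n.
  by rewrite -mulrA -invfM -expr2 sqr_sqrtr.
(* The sign [s] treats both exponents at once: [s = -1] gives the lower bound, [s = 1] the upper.
   Numerator and denominator are divided by [n]. *)
have lim (s : R) :
    expR (- ((j n)%:R ^+ 2 / (n%:R + s * (j n)%:R))) @[n --> \oo]
    --> expR (- a ^+ 2).
  apply: (@continuous_cvg _ _ _ _ _ _ expR); first exact: continuous_expR.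
  apply: cvgN.
  have : ((j n)%:R / Num.sqrt n%:R) * ((j n)%:R / Num.sqrt n%:R)
      / (1 + s * ((j n)%:R / n%:R)) @[n --> \oo] --> a * a / (1 + s * 0).
    apply: cvgM; first exact: cvgM.
    apply: cvgV; first by rewrite mulr0 addr0 oner_eq0.
    by apply: cvgD; [exact: cvg_cst|apply: cvgM => //; exact: cvg_cst].
  rewrite mulr0 addr0 divr1 -expr2; apply: cvg_trans.
  apply: near_eq_cvg; near=> n.
  have n0 : n%:R != 0 :> R.
    by rewrite pnatr_eq0 -lt0n; near: n; exact: nbhs_infty_gt.
  rewrite mulrACA -expr2 -invfM -expr2 sqr_sqrtr// -mulrA -invfM.
  by congr (_ / _); field.
apply: squeeze_cvgr (lim (-1)) (lim 1).
near=> n; rewrite mulN1r mul1r; apply: bin_central_ratio_bounds.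
have n0 : 0 < n%:R :> R by rewrite ltr0n; near: n; exact: nbhs_infty_gt.
(* The bounds require [j n < n], which holds eventually because [j n / n] tends to [0 < 1]. *)
rewrite -(ltr_nat R) -[ltRHS]mul1r -ltr_pdivrMr//.
near: n; exact: (cvgr_lt _ j0).
Unshelve. all: end_near. Qed.

(** An even number is the double of its half, so a threshold [N] for the doubled sequence becomes
    [2N]. *)
Lemma cvg_even_infty (T : topologicalType) (f : nat -> T) (l : T) :
  f n.*2 @[n --> \oo] --> l -> f n @[n --> even_infty] --> l.
Proof.
move=> fl A /fl [N _ NA]; exists N.*2 => // n /= Nn [_ n_even].
by rewrite -(even_halfK n_even); apply: NA; rewrite /= -leq_double even_halfK.
Qed.

Lemma shifted_index_double (R : realType) (c : R) (m : nat) : 0 <= c ->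
  shifted_index c m.*2
    = (m + `|Num.floor (2^-1 * c * Num.sqrt 2 * Num.sqrt m%:R)|)%N.
Proof.
move=> c0; rewrite /shifted_index -muln2 natrM sqrtrM//.
have -> : 2^-1 * (m%:R * 2) = m%:R :> R by field.
rewrite [Num.sqrt m%:R * _]mulrC mulrA.
set y := _ * Num.sqrt m%:R.
have : 0 <= Num.floor y by rewrite floor_ge0 /y !mulr_ge0// invr_ge0.
(* The integer [m] comes out of the floor; as [floor y >= 0], the absolute value of the sum splits
   too. *)
rewrite addrC floorDrz ?natr_int// (intrKfloor m%:Z).
by case: (Num.floor y) => // k _; rewrite -PoszD absz_nat addnC.
Qed.

Theorem mainTheorem6 (R : realType) (c : R) (hc : 0 <= c) :
  (binom_half R n (shifted_index c n) / binom_half R n n./2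
     @[n --> even_infty] --> expR (- (2^-1 * c ^+ 2)))
  /\
  ('C(n, shifted_index c n)%:R / 'C(n, n./2)%:R : R)
     @[n --> even_infty] --> expR (- (2^-1 * c ^+ 2)).
Proof.
have key : ('C(n, shifted_index c n)%:R / 'C(n, n./2)%:R : R)
    @[n --> even_infty] --> expR (- (2^-1 * c ^+ 2)).
  apply: cvg_even_infty.
  (* With [n = 2m], the offset is the floor of [a * sqrt m] for [a = c/2 * sqrt 2], and
     [a^2 = c^2/2]. *)
  have -> : 2^-1 * c ^+ 2 = (2^-1 * c * Num.sqrt 2) ^+ 2.
    by rewrite !exprMn sqr_sqrtr//; field.
  under eq_fun do rewrite shifted_index_double// doubleK.
  apply: cvg_bin_central_ratio; apply: cvg_floor_sqrtn.
  by rewrite !mulr_ge0// invr_ge0.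
(* The common factor [(1/2)^n] cancels, so the first limit is the second. *)
split => //; under eq_fun do rewrite /binom_half -mulf_div divff ?mulr1//.
exact: key.
Qed.
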